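(* Let $F$ be a graph such that $\mathrm{ex}(n,K_3,F)=o(n^2)$. Then $\mathrm{th}(F)\le (\chi(F)-1)(|V(F)|-1)+1$.
   Context: $\mathrm{ex}(n,H,F)$ (generalized Turán number) is the maximum number of copies of $H$ in an $F$-free $n$-vertex graph; asymptotics are as $n\to\infty$. A hypergraph $\mathcal{H}$ is a Berge copy of a graph $G$ if $V(G)\subseteq V(\mathcal{H})$ and there is a bijection $f:E(G)\to E(\mathcal{H})$ with $e\subseteq f(e)$ for all $e\in E(G)$. $\mathrm{ex}_r(n,\text{Berge-}F)$ is the maximum number of hyperedges in an $r$-uniform $n$-vertex hypergraph with no Berge copy of $F$. For every $F$ there is $r_0$ with $\mathrm{ex}_r(n,\text{Berge-}F)=o(n^2)$ for all $r\ge r_0$; the uniformity threshold $\mathrm{th}(F)$ is the smallest such $r_0$. $\chi(F)$ is the chromatic number of $F$. *)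

(* Defs.v *)
From mathcomp Require Import all_boot all_order all_algebra.
Set Implicit Arguments. Unset Strict Implicit. Unset Printing Implicit Defensive.
Import Order.TTheory GRing.Theory Num.Theory.

Definition simple_graph (V : finType) (E : {set {set V}}) : bool :=
  [forall e in E, #|e| == 2].

Definition contains_copy (V W : finType) (EF : {set {set V}}) (EG : {set {set W}}) : bool :=
  [exists f : {ffun V -> W}, injectiveb f && [forall e in EF, (f @: e) \in EG]].

Definition triangles (n : nat) (E : {set {set 'I_n}}) : nat :=
  #|[set T : {set 'I_n} | (#|T| == 3) &&
      [forall x in T, forall y in T, (x != y) ==> ([set x; y] \in E)]]|.

Definition ex_K3 (V : finType) (EF : {set {set V}}) (n : nat) : nat :=
  \max_(E : {set {set 'I_n}} | simple_graph E && ~~ contains_copy EF E) triangles E.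

Definition uniform (W : finType) (r : nat) (H : {set {set W}}) : bool :=
  [forall h in H, #|h| == r].

Definition contains_berge (V W : finType) (EF : {set {set V}}) (H : {set {set W}}) : bool :=
  [exists phi : {ffun V -> W}, exists g : {ffun {set V} -> {set W}},
    [&& injectiveb phi,
        [forall e1 in EF, forall e2 in EF, (g e1 == g e2) ==> (e1 == e2)] &
        [forall e in EF, (g e \in H) && (phi @: e \subset g e)]]].

Definition ex_berge (V : finType) (r : nat) (EF : {set {set V}}) (n : nat) : nat :=
  \max_(H : {set {set 'I_n}} | uniform r H && ~~ contains_berge EF H) #|H|.

Definition colorable (V : finType) (EF : {set {set V}}) (k : nat) : bool :=
  [exists f : {ffun V -> 'I_k},
    [forall x, forall y, ((x != y) && ([set x; y] \in EF)) ==> (f x != f y)]].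

Lemma colorable_ex (V : finType) (EF : {set {set V}}) : exists k, colorable EF k.
Proof.
exists #|V|; apply/existsP; exists [ffun x => enum_rank x].
apply/forallP=> x; apply/forallP=> y; apply/implyP=> /andP[nxy _].
rewrite !ffunE; apply: contra nxy => /eqP/enum_rank_inj ->; exact: eqxx.
Qed.

Definition chi (V : finType) (EF : {set {set V}}) : nat := ex_minn (colorable_ex EF).

Definition is_o_n2 (f : nat -> nat) : Prop :=
  forall eps : rat, (0 < eps)%R -> exists N : nat, forall n : nat, (N <= n)%N ->
    ((f n)%:R <= eps * (n%:R) ^+ 2 :> rat)%R.

(* Main.v *)
Require Import Defs.
From mathcomp Require Import all_boot all_order all_algebra.
From mathcomp Require Import zify.
Set Implicit Arguments. Unset Strict Implicit. Unset Printing Implicit Defensive.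
Import Order.TTheory GRing.Theory Num.Theory.

(** Let [H] be an [r]-uniform Berge-[F]-free hypergraph.  Call a pair of vertices red if its
codegree is at least [#|E(F)|] and blue otherwise.  A copy of [F] in which some edges are red and
the others are blue pairs taken from distinct hyperedges extends greedily to a Berge copy of [F].
- If [F] is bipartite, a hyperedge without blue pairs is a red clique on [r >= #|V(F)|] vertices.
  So every hyperedge has a blue pair, and dense graphs contain [F].
- Otherwise [r > 2 (#|V(F)| - 1)].  For the hyperedges with a red-red-blue triangle, the graph made
  of the red pairs and of one blue pair per such hyperedge is [F]-free and has a number of triangles
  proportional to the number of these hyperedges, hence there are [o(n^2)] of them.
  For the hyperedges with a blue triangle, if they are not [o(n^2)] then the Ruzsa-Szemeredi theorem
  gives [c n^2] triangles whose edges come from three distinct hyperedges; choosing one of the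
  three pairs in each hyperedge keeps a positive proportion of these for some choice, which again
  contradicts [ex(n, K_3, F) = o(n^2)].
  In the other hyperedges, red is an equivalence relation with at most two classes, one of which
  has [#|V(F)|] vertices.
*)

(** * Counting by fibers *)

Lemma card_le_fibers (A B : finType) (f : A -> B) (P : {set A}) (Q : {set B}) d :
  {in P, forall a, f a \in Q} ->
  (forall b, b \in Q -> #|[set a in P | f a == b]| <= d) -> #|P| <= d * #|Q|.
Proof.
move=> fPQ fib; rewrite -sum1_card (partition_big f (mem Q)) //=.
rewrite mulnC -sum_nat_const; apply: leq_sum => b bQ.
by rewrite sum1dep_card; have := fib b bQ; rewrite cardsE.
Qed.

Lemma card_fiber_sum (A B : finType) (f : A -> B) (P : {set A}) :
  #|P| = \sum_(b : B) #|[set a in P | f a == b]|.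
Proof.
rewrite -sum1_card (partition_big f xpredT) //=; apply: eq_bigr => b _.
by rewrite sum1dep_card cardsE.
Qed.

(** * Rainbow triangles and the Ruzsa-Szemeredi theorem *)

Definition pair_bounded (T W : finType) d (x y : T -> W) :=
  forall a b, #|[set t | (x t == a) && (y t == b)]| <= d.

(** A member [(t1, t2, t3)] encodes a triangle on [x t3], [y t3], [z t1] whose sides come from
    distinct indices: the xz side from [t1], the yz side from [t2], the xy side from [t3]. *)
Definition rainbow (T W : finType) (x y z : T -> W) : {set T * T * T} :=
  [set w | [&& w.1.1 != w.1.2, w.1.1 != w.2, w.1.2 != w.2,
              x w.1.1 == x w.2, y w.1.2 == y w.2 & z w.1.1 == z w.1.2]].

Section RemovalStep.

Variables (W T : finType) (d m : nat).

(** Fix the part of [x t] and the value [z t]. The bad [t] of this class have [x t] in a set smaller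
    than [1/m] of the part, and each value of [x t] occurs at most [d] times. Summing over parts and
    over [z] gives the bound. *)
Lemma card_bad (L : finType) (x z : T -> W) (p : W -> L) :
  pair_bounded d x z ->
  m * #|[set t | m * #|[set a | (p a == p (x t)) && [exists s, (z s == z t) && (x s == a)]]|
                 < #|[set a | p a == p (x t)]| ]| <= d * #|W| ^ 2.
Proof.
move=> dxz; set bad := [set t | _].
rewrite (card_fiber_sum (fun t => (p (x t), z t)) bad) big_distrr /=.
have -> : d * #|W| ^ 2 = \sum_(c : L * W) d * #|[set a | p a == c.1]|.
  rewrite -(pair_bigA _ (fun i (_ : W) => d * #|[set a | p a == i]|)) /=.
  under eq_bigr => i _ do rewrite sum_nat_const mulnCA.
  rewrite -!big_distrr /= -mulnn; congr (_ * (_ * _)).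
  rewrite -cardsT (card_fiber_sum p).
  by apply: eq_bigr => i _; apply: eq_card => a; rewrite !inE.
apply: leq_sum => -[i c] _ /=.
have [->|[t0]] := set_0Vmem [set t in bad | (p (x t), z t) == (i, c)].
  by rewrite cards0 muln0.
rewrite !inE => /andP[lt0 /eqP[p0 z0]]; rewrite p0 z0 in lt0.
set U := [set a | _] in lt0.
have le1 : #|[set t in bad | (p (x t), z t) == (i, c)]| <= d * #|U|.
  apply: (card_le_fibers (f := x)) => [t|a _].
    rewrite !inE => /andP[_ /eqP[-> <-]]; rewrite eqxx /=.
    by apply/existsP; exists t; rewrite !eqxx.
  apply: leq_trans (dxz a c); apply: subset_leq_card; apply/subsetP => t.
  by rewrite !inE xpair_eqE => /andP[/andP[_ /andP[_ ->]] ->].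
by apply: leq_trans (leq_mul (leqnn m) le1) _; rewrite mulnCA leq_mul // ltnW.
Qed.


Variables (x y z : T -> W).
Hypotheses (dxy : pair_bounded d x y) (dxz : pair_bounded d x z) (dyz : pair_bounded d y z).

(* If [(x, y)] is the pair of a good [t], then [x s] for [z s = z t] and [y s] for [z s = z t] fill
fixed proportions [U] and [V] of the cell of [(x, y)], while pairs of [T] in [U * V] yield rainbow
triangles, apart from linearly many exceptions.  Deleting one such rectangle from each good cell
therefore shrinks the region [S] by a fixed proportion of [#|W| ^ 2], independent of the numbers
[#|L|] and [#|M|] of parts, while [S] still contains almost all pairs. *)
Lemma removal_step (e : nat) (L M : finType) (p : W -> L) (q : W -> M) (S : {set L * M}) :
  m = 8 * d * e -> #|W| ^ 2 <= e * #|T| ->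
  4 * e * #|[set t | (p (x t), q (y t)) \notin S]| <= #|W| ^ 2 ->
  exists (L' M' : finType) (p' : W -> L') (q' : W -> M') (S' : {set L' * M'}),
  [/\ #|L'| = #|L| * 2 ^ #|M|, #|M'| = #|M| * 2 ^ #|L|,
      #|[set t | (p' (x t), q' (y t)) \notin S']| <=
        #|[set t | (p (x t), q (y t)) \notin S]| + (#|rainbow x y z| + d ^ 2 * (#|L| * #|M|) *
          #|W|) &
      2 * e * d * m ^ 2 * #|[set ab | (p' ab.1, q' ab.2) \in S']| + #|W| ^ 2 <=
        2 * e * d * m ^ 2 * #|[set ab | (p ab.1, q ab.2) \in S]| ].
Proof.
move=> def_m leT lost.
pose U c a := [exists s, (z s == c) && (x s == a)].
pose V c b := [exists s, (z s == c) && (y s == b)].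
pose goodx t := #|[set a | p a == p (x t)]| <= m * #|[set a | (p a == p (x t)) && U (z t) a]|.
pose goody t := #|[set b | q b == q (y t)]| <= m * #|[set b | (q b == q (y t)) && V (z t) b]|.
pose cell t := (p (x t), q (y t)).
(* Each cell with a good index gets the rectangle [U c * V c] for one such [z]-value [c]; [None]
   marks the cells without good index. *)
pose zc i j := omap z [pick t | [&& goodx t, goody t & cell t == (i, j)]].
(* The new label of [a] records for which [j] it lies on the [U] side of the rectangle of cell
   [(p a, j)]. With [be] for the other side, the region left after deleting all rectangles is again
   a union of cells. *)
pose al a := [set j | if zc (p a) j is Some c then U c a else false].
pose be b := [set i | if zc i (q b) is Some c then V c b else false].
pose S' := [set c : (L * {set M}) * (M * {set L}) |
  ((c.1.1, c.2.1) \in S) && ~~ ((c.2.1 \in c.1.2) && (c.1.1 \in c.2.2))].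
pose rem ab := if zc (p ab.1) (q ab.2) is Some c then U c ab.1 && V c ab.2 else false.
exists (L * {set M})%type, (M * {set L})%type, (fun a => (p a, al a)), (fun b => (q b, be b)), S'.
have inS' a b : (((p a, al a), (q b, be b)) \in S') = ((p a, q b) \in S) && ~~ rem (a, b).
  by rewrite !inE /rem /=; case: (zc _ _).
split; rewrite ?card_prod //.
- by rewrite -[#|{set M}|]cardsT -powersetT card_powerset cardsT.
- by rewrite -[#|{set L}|]cardsT -powersetT card_powerset cardsT.
(* The exceptions: in [E2] the cell determines [z t], so the cell and [x t] leave at most [d]
   indices; [Ex] adds the indices with the same pair [(x, y)]. *)
- pose E2 := [set t | zc (cell t).1 (cell t).2 == Some (z t)].
  pose Ex := [set t | [exists s in E2, (x s == x t) && (y s == y t)]].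
  have cardE2 : #|E2| <= d * (#|L| * #|M| * #|W|).
    have -> : #|L| * #|M| * #|W| = #|[set: L * M * W]| by rewrite cardsT !card_prod.
    apply: (card_le_fibers (f := fun t => (cell t, x t))) => [t|[[i j] a] _]; first by rewrite inE.
    have [->|[t0]] := set_0Vmem [set t in E2 | (cell t, x t) == (i, j, a)]; first by rewrite cards0.
    rewrite !inE => /andP[/eqP z0 /eqP[pi qj _]]; rewrite /cell /= pi qj in z0.
    apply: leq_trans (dxz a (z t0)); apply: subset_leq_card; apply/subsetP => t.
    by rewrite !inE /= => /andP[/eqP zt /eqP[pt qt ->]]; rewrite pt qt z0 in zt; case: zt => ->;
      rewrite !eqxx.
  have cardEx : #|Ex| <= d * #|E2|.
    apply: leq_trans (leq_mul (leqnn d) (leq_imset_card (fun s => (x s, y s)) (mem E2))).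
    apply: (card_le_fibers (f := fun t => (x t, y t))) => [t|[a b] _].
      rewrite inE => /existsP[s /and3P[sE /eqP <- /eqP <-]]; exact: imset_f.
    apply: leq_trans (dxy a b); apply: subset_leq_card; apply/subsetP => t.
    by rewrite !inE xpair_eqE => /andP[_].
  set lost0 := [set t | _ \notin S]; set lost1 := [set t | _ \notin S'].
  (* A newly lost [t] has [t1] and [t2] with [z]-value [c] sharing [x t] and [y t] respectively. If
     the three indices are distinct they form a rainbow triangle; any coincidence puts [t] in
     [Ex]. *)
  have sub : lost1 \subset lost0 :|: ([set w.2 | w in rainbow x y z] :|: Ex).
    apply/subsetP => t; rewrite !in_setU inE [t \in lost0]inE inS' negb_and negbK.
    case/orP => [-> //|]; rewrite /rem /=.
    case zcE: (zc _ _) => [c|//] /andP[/existsP[t1 /andP[/eqP z1 /eqP x1]] /existsP[t2 /andP[/eqP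
      z2 /eqP y2]]].
    have inEx s : x s = x t -> y s = y t -> z s = c -> t \in Ex.
      move=> xs ys zs; rewrite inE; apply/existsP; exists s.
      by rewrite inE /cell /= xs ys zs zcE !eqxx.
    have [e12|n12] := eqVneq t1 t2; first by rewrite (inEx t1) ?orbT // e12.
    have [e13|n13] := eqVneq t1 t; first by rewrite (inEx t1) ?orbT // e13.
    have [e23|n23] := eqVneq t2 t; first by rewrite (inEx t2) ?orbT // e23.
    suff -> : t \in [set w.2 | w in rainbow x y z] by rewrite orbT.
    by apply/imsetP; exists (t1, t2, t) => //; rewrite inE /= n12 n13 n23 x1 y2 z1 z2 !eqxx.
  apply: leq_trans (subset_leq_card sub) _.
  apply: leq_trans (leq_card_setU _ _) _; rewrite leq_add2l.
  apply: leq_trans (leq_card_setU _ _) _; apply: leq_add; first exact: leq_imset_card.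
  by apply: leq_trans cardEx _; rewrite -mulnn -!mulnA leq_mul2l !mulnA in cardE2 *;
    rewrite cardE2 orbT.
pose GM := [set ab | ((p ab.1, q ab.2) \in S) && (zc (p ab.1) (q ab.2) != None)].
pose Rem := [set ab | ((p ab.1, q ab.2) \in S) && rem ab].
pose Good := [set t | [&& cell t \in S, goodx t & goody t]].
set mass := #|[set ab | (p ab.1, q ab.2) \in S]|.
set mass' := #|[set ab | ((p ab.1, al ab.1), (q ab.2, be ab.2)) \in S']|.
have massE : mass = #|Rem| + mass'.
  rewrite /mass /mass' -(cardsID [set ab | rem ab] [set ab | (p ab.1, q ab.2) \in S]).
  congr (_ + _).
    by congr #|pred_of_set _|; apply/setP => -[a b]; rewrite in_setI !in_set.
  by congr #|pred_of_set _|; apply/setP => -[a b]; rewrite in_setD 2!in_set [RHS]in_set inS' andbC.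
have GoodGM : #|Good| <= d * #|GM|.
  apply: (card_le_fibers (f := fun t => (x t, y t))) => [t|[a b] _].
    rewrite !inE /= => /and3P[-> gx gy] /=; rewrite /zc; case: pickP => //= /(_ t).
    by rewrite gx gy eqxx.
  apply: leq_trans (dxy a b); apply: subset_leq_card; apply/subsetP => t.
  by rewrite !inE xpair_eqE => /andP[_].
(* Goodness makes each side of the rectangle at least [1/m] of the corresponding part, whence the
   factor [m ^ 2]. *)
have GMRem : #|GM| <= m ^ 2 * #|Rem|.
  rewrite (card_fiber_sum (fun ab => (p ab.1, q ab.2)) GM).
  rewrite (card_fiber_sum (fun ab => (p ab.1, q ab.2)) Rem) big_distrr /=.
  apply: leq_sum => -[i j] _.
  have [->|[[a0 b0]]] := set_0Vmem [set ab in GM | (p ab.1, q ab.2) == (i, j)];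
    first by rewrite cards0.
  rewrite !inE /= => /andP[/andP[ijS zc0] /eqP[pa qb]]; rewrite pa qb in ijS zc0.
  case zcE: (zc i j) zc0 => [c|//] _; move: (zcE); rewrite /zc.
  case: pickP => //= t0 /and3P[gx gy /eqP[pt qt]] [zt].
  rewrite /goodx /goody pt qt zt in gx gy.
  apply: leq_trans (_ : #|setX [set a | p a == i] [set b | q b == j]| <= _).
    by apply: subset_leq_card; apply/subsetP => -[a b]; rewrite !inE xpair_eqE /= => /andP[_].
  rewrite cardsX; apply: leq_trans (leq_mul gx gy) _.
  rewrite mulnACA mulnn -cardsX leq_mul2l; apply/orP; right.
  apply: subset_leq_card; apply/subsetP => -[a b];
    rewrite !inE /= => /andP[/andP[/eqP pa' Ua] /andP[/eqP qb' Vb]].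
  by rewrite /rem /= pa' qb' zcE Ua Vb ijS eqxx.
have badx := card_bad p dxz; have bady := card_bad q dyz.
have cover : #|T| <= #|Good| + (#|[set t | cell t \notin S]| +
    (#|[set t | ~~ goodx t]| + #|[set t | ~~ goody t]|)).
  rewrite -cardsT.
  have -> : [set: T] = Good :|: ([set t | cell t \notin S] :|: ([set t | ~~ goodx t] :|: [set t |
    ~~ goody t])).
    by apply/setP => t; rewrite !inE; case: (_ \in S); case: (goodx t); case: (goody t).
  apply: leq_trans (leq_card_setU _ _) _; rewrite leq_add2l.
  by apply: leq_trans (leq_card_setU _ _) _; rewrite leq_add2l leq_card_setU.
have bx' : m * #|[set t | ~~ goodx t]| <= d * #|W| ^ 2.
  by apply: leq_trans badx; rewrite leq_mul2l; apply/orP; right; apply: subset_leq_card;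
    apply/subsetP => t;
    rewrite !inE -ltnNge.
have by' : m * #|[set t | ~~ goody t]| <= d * #|W| ^ 2.
  by apply: leq_trans bady; rewrite leq_mul2l; apply/orP; right; apply: subset_leq_card;
    apply/subsetP => t;
    rewrite !inE -ltnNge.
rewrite massE.
set G := #|Good| in GoodGM cover; set GMc := #|GM| in GoodGM GMRem; set Rm := #|Rem| in GMRem *.
set lo := #|[set t | cell t \notin S]| in cover.
set b1 := #|[set t | ~~ goodx t]| in bx' cover; set b2 := #|[set t | ~~ goody t]| in by' cover.
have {}lost : 4 * e * lo <= #|W| ^ 2 by [].
move: leT lost; set N := #|W| ^ 2 in bx' by' *; move=> leT lost.
rewrite mulnDr [leqRHS]addnC leq_add2l.
have [d0|d_gt0] := posnP d.
  suff T0 : #|T| = 0 by rewrite T0 muln0 in leT; apply: leq_trans leT _.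
  apply: eq_card0 => t; have := dxy (x t) (y t); rewrite d0 leqn0 cards_eq0 => /eqP/setP/(_ t).
  by rewrite !inE !eqxx.
(* Since [m = 8 * d * e], each kind of badness costs at most [N / (8e)] indices, and at most
   [N / (4e)] were lost before; of the at least [N / e] indices, [N / (2e)] are therefore good. *)
have b1' : 8 * e * b1 <= N by rewrite -(leq_pmul2l d_gt0); move: bx'; rewrite def_m; nia.
have b2' : 8 * e * b2 <= N by rewrite -(leq_pmul2l d_gt0); move: by'; rewrite def_m; nia.
have: N <= 2 * e * G by nia.
move/leq_trans; apply.
have: G <= d * (m ^ 2 * Rm) by apply: leq_trans GoodGM _; rewrite leq_mul2l GMRem orbT.
move=> leG; apply: leq_trans (leq_mul (leqnn (2 * e)) leG) _; lia.
Qed.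

End RemovalStep.

(** [k] removal steps starting from the one-cell partition. Part numbers grow from [K] to at most
    [K * 2 ^ K], so [K] and [C] are independent of [W]. The smallness hypothesis keeps the loss low
    enough for every round. *)
Lemma removal_iter (d e k : nat) : exists K C, forall (W T : finType) (x y z : T -> W),
  pair_bounded d x y -> pair_bounded d x z -> pair_bounded d y z ->
  #|W| ^ 2 <= e * #|T| ->
  4 * e * (C * #|W| + k * #|rainbow x y z|) <= #|W| ^ 2 ->
  exists (L M : finType) (p : W -> L) (q : W -> M) (S : {set L * M}),
  [/\ #|L| <= K, #|M| <= K,
      #|[set t | (p (x t), q (y t)) \notin S]| <= C * #|W| + k * #|rainbow x y z| &
      2 * e * d * (8 * d * e) ^ 2 * #|[set ab | (p ab.1, q ab.2) \in S]| + k * #|W| ^ 2 <=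
        2 * e * d * (8 * d * e) ^ 2 * #|W| ^ 2].
Proof.
elim: k => [|k [K [C IH]]].
  exists 1, 0 => W T x y z _ _ _ _ _.
  exists unit, unit, (fun=> tt), (fun=> tt), setT; split; rewrite ?card_unit //.
    by rewrite leqn0 cards_eq0; apply/eqP/setP => t; rewrite !inE.
  rewrite addn0 leq_mul2l -[#|W| ^ 2]mulnn -card_prod max_card orbT //.
exists (K * 2 ^ K), (C + d ^ 2 * (K * K)) => W T x y z dxy dxz dyz leT small.
set R := #|rainbow x y z| in small *.
have small' : 4 * e * (C * #|W| + k * R) <= #|W| ^ 2.
  by apply: leq_trans small; rewrite leq_mul2l; apply/orP; right; nia.
have [L [M [p [q [S [LK MK lost mass]]]]]] := IH _ _ _ _ _ dxy dxz dyz leT small'.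
have lost' : 4 * e * #|[set t | (p (x t), q (y t)) \notin S]| <= #|W| ^ 2.
  by apply: leq_trans small'; rewrite leq_mul2l lost orbT.
have [L' [M' [p' [q' [S' [cL cM lost1 mass1]]]]]] := removal_step dxy dxz dyz (erefl _) leT lost'.
exists L', M', p', q', S'; split.
- by rewrite cL leq_mul // leq_exp2l.
- by rewrite cM leq_mul // leq_exp2l.
- apply: leq_trans lost1 _.
  have : d ^ 2 * (#|L| * #|M|) * #|W| <= d ^ 2 * (K * K) * #|W| by rewrite leq_mul // leq_mul //
    leq_mul.
  move: lost; rewrite -/R; nia.
- by rewrite mulSn addnA; apply: leq_trans mass; rewrite leq_add2r.
Qed.

(* The Ruzsa-Szemeredi (6,3)-theorem, for the triples [(x t, y t, z t)]. *)
Lemma many_rainbow (d e : nat) : exists c N, forall (W T : finType) (x y z : T -> W),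
  pair_bounded d x y -> pair_bounded d x z -> pair_bounded d y z ->
  N <= #|W| -> #|W| ^ 2 <= e * #|T| -> #|W| ^ 2 <= c * #|rainbow x y z|.
Proof.
set g := 2 * e * d * (8 * d * e) ^ 2.
(* After [g.+1] rounds the mass inequality would give [g.+1 * #|W| ^ 2 <= g * #|W| ^ 2], absurd for
   nonempty [W]. *)
have [K [C H]] := removal_iter d e g.+1.
(* Each constant keeps one of the two terms of the smallness hypothesis below [#|W| ^ 2 / 2]. *)
exists (8 * e * g.+1), (8 * e * C).+1 => W T x y z dxy dxz dyz leN leT.
rewrite leqNgt; apply/negP => ltR.
have [|L [M [p [q [S [_ _ _]]]]]] := H W T x y z dxy dxz dyz leT; first by nia.
rewrite -/g; nia.
Qed.

(** * Selecting roles and distinct representatives *)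

(** Averaging: a uniformly random [f] gives three distinct indices their prescribed roles with
    probability [1/27]. *)
Lemma select_roles (T : finType) (R : {set T * T * T}) :
  {in R, forall w, [&& w.1.1 != w.1.2, w.1.1 != w.2 & w.1.2 != w.2]} ->
  exists f : {ffun T -> 'I_3},
    #|R| <= 27 * #|[set w in R | [&& f w.1.1 == 0 :> nat, f w.1.2 == 1 :> nat & f w.2 == 2 :>
      nat]]|.
Proof.
move=> dist; pose role (f : {ffun T -> 'I_3}) (w : T * T * T) :=
  [&& f w.1.1 == 0 :> nat, f w.1.2 == 1 :> nat & f w.2 == 2 :> nat].
have many w : w \in R -> 3 ^ #|T| <= 27 * #|[set f | role f w]|.
  case: w => -[a b] c /dist /= /and3P[nab nac nbc].
  pose i0 : 'I_3 := inord 0; pose i1 : 'I_3 := inord 1; pose i2 : 'I_3 := inord 2.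
  pose F (g : {ffun T -> 'I_3}) :=
    [ffun t => if t == a then i0 else if t == b then i1 else if t == c then i2 else g t].
  have -> : 3 ^ #|T| = #|[set: {ffun T -> 'I_3}]| by rewrite cardsT card_ffun card_ord.
  apply: (card_le_fibers (f := F)) => [g _|h _].
    rewrite inE /role /= !ffunE !eqxx [b == a]eq_sym [c == a]eq_sym [c == b]eq_sym.
    by rewrite (negbTE nab) (negbTE nac) (negbTE nbc) !inordK.
  (* Functions with the same image under [F] differ only at [a], [b], [c], so a fiber has at most
     [3 ^ 3] elements. *)
  pose val3 (g : {ffun T -> 'I_3}) := (g a, g b, g c).
  rewrite -(card_in_imset (f := val3)); last first.
    move=> g g'; rewrite !inE => /= /eqP Fg /eqP Fg' [ea eb ec]; apply/ffunP => t.
    have := congr1 (fun u : {ffun T -> 'I_3} => u t) (etrans Fg (esym Fg')); rewrite !ffunE.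
    by case: eqP => [->|_] //; case: eqP => [->|_] //; case: eqP => [->|_].
  by apply: leq_trans (max_card _) _; rewrite !card_prod !card_ord.
have [/existsP[f leR]|] := boolP [exists f, #|R| <= 27 * #|[set w in R | role f w]|];
  first by exists f.
rewrite negb_exists => /forallP small; exfalso.
have dbl : \sum_(f : {ffun T -> 'I_3}) #|[set w in R | role f w]| = \sum_(w in R) #|[set f | role
  f w]|.
  transitivity (\sum_(f : {ffun T -> 'I_3}) \sum_(w in R) role f w).
    apply: eq_bigr => f _; rewrite -sum1dep_card (big_mkcondr _ (index_enum _) (mem R) (role f)).
    by apply: eq_bigr => w _; case: (role f w).
  rewrite exchange_big /=; apply: eq_bigr => w _.
  by rewrite -sum1dep_card [RHS]big_mkcond; apply: eq_bigr => f _; case: (role f w).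
have le1 : #|R| * 3 ^ #|T| <= 27 * \sum_(w in R) #|[set f | role f w]|.
  by rewrite -sum_nat_const big_distrr /=; apply: leq_sum => w /many.
(* If every [f] fails, it fails strictly; the successor keeps this strictness in the sum. *)
have : \sum_(f : {ffun T -> 'I_3}) (27 * #|[set w in R | role f w]|).+1 <= \sum_(f : {ffun T ->
  'I_3}) #|R|.
  by apply: leq_sum => f _; rewrite ltnNge; apply: small.
under eq_bigr => f _ do rewrite -addn1.
rewrite big_split /= -big_distrr /= dbl !sum_nat_const card_ffun card_ord.
have : 0 < 3 ^ #|T| by rewrite expn_gt0.
move: le1; set N := 3 ^ _; rewrite [#|R| * N]mulnC; set u := N * _; set s := \sum_(w in R) _.
by lia.
Qed.

Lemma distinct_choice (A B : finType) (D P : {set A}) (C : A -> {set B}) (g0 : A -> B) :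
  [disjoint D & P] -> {in D &, injective g0} -> {in P, forall a, #|D :|: P| <= #|C a|} ->
  exists g : A -> B, [/\ {in D :|: P &, injective g}, {in D, g =1 g0} & {in P, forall a, g a \in C
    a}].
Proof.
move=> + inj0; have [k] := ubnP #|P|; elim: k P => // k IH P /ltnSE leP dDP leC.
have [P0|[a aP]] := set_0Vmem P.
  by exists g0; split=> // [|a]; rewrite P0 ?setU0 ?inE.
have aD : a \notin D by apply: contraTN dDP => aD; apply/pred0Pn; exists a; rewrite /= aD.
have defP : D :|: P = a |: (D :|: P :\ a) by rewrite setUCA setD1K.
have aDP : a \notin D :|: P :\ a by rewrite !inE eqxx (negbTE aD).
have cDP : #|D :|: P| = #|D :|: P :\ a|.+1 by rewrite defP cardsU1 aDP.
have [||b /setD1P[_ /leC]|g [ginj gD gC]] := IH (P :\ a).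
- by move: leP; rewrite (cardsD1 a) aP add1n.
- exact: disjointWr (subD1set _ _) dDP.
- by rewrite cDP; apply: ltnW.
have [b bC bN] : exists2 b, b \in C a & b \notin g @: (D :|: P :\ a).
  apply/subsetPn; apply: contraTN (leC a aP) => /subset_leq_card.
  by rewrite -ltnNge cDP ltnS => /leq_trans; apply; apply: leq_imset_card.
exists (fun t => if t == a then b else g t); split.
- move=> s t; rewrite defP => /setU1P[->|sDP] /setU1P[->|tDP] //; rewrite ?eqxx.
  + case: eqP => [-> //|_ bE]; case/imsetP: bN; by exists t.
  + case: eqP => [-> //|_ bE]; case/imsetP: bN; by exists s.
  + have /negbTE-> : s != a by apply: contraNneq aDP => {1}<-.
    have /negbTE-> : t != a by apply: contraNneq aDP => {1}<-.
    exact: ginj.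
- by move=> t tD; rewrite ifN ?gD //; apply: contraNneq aD => <-.
- by move=> t tP; case: eqP => [-> //|/eqP nta]; apply: gC; rewrite !inE nta.
Qed.

Definition codegree (W : finType) (H : {set {set W}}) (e : {set W}) := #|[set h in H | e \subset
  h]|.

(** * From copies of a graph to Berge copies *)

(** The edges mapped onto some [pr t] form [D] and receive [hyp t]; injectivity of [hyp] separates
    them. Every other edge has at least [#|EF|] candidate hyperedges, enough for the greedy
    choice. *)
Lemma berge_of_copy (V W T : finType) (EF : {set {set V}}) (H G : {set {set W}})
    (hyp pr : T -> {set W}) :
  injective hyp -> (forall t, hyp t \in H) -> (forall t, pr t \subset hyp t) ->
  (forall e, e \in G -> #|EF| <= codegree H e \/ exists t, pr t = e) ->
  contains_copy EF G -> contains_berge EF H.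
Proof.
move=> hyp_inj hypH pr_hyp GP /existsP[phi /andP[/injectiveP phi_inj /forall_inP phiG]].
pose D := [set e in EF | [exists t, pr t == phi @: e]].
pose g0 (e : {set V}) := if [pick t | pr t == phi @: e] is Some t then hyp t else set0.
have g0P e : e \in D -> exists2 t, pr t = phi @: e & g0 e = hyp t.
  rewrite inE /g0 => /andP[_ /existsP[t0 pt0]].
  by case: pickP => [t /eqP|/(_ t0)]; [exists t | rewrite pt0].
have DU : D :|: EF :\: D = EF.
  by rewrite -[RHS](setID _ D) (setIidPr _) //; apply/subsetP => e; rewrite inE => /andP[].
have [||e|g []] := @distinct_choice _ _ D (EF :\: D) (fun e =>
  [set h in H | phi @: e \subset h]) g0.
- by rewrite disjoint_sym disjoints_subset subsetDr.
- move=> e1 e2 /g0P[t1 p1 ->] /g0P[t2 p2 ->] /hyp_inj e12.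
  by apply: (imset_inj phi_inj); rewrite -p1 -p2 e12.
- rewrite DU 2!inE => /andP[nD eEF]; rewrite eEF /= in nD.
  case: (GP _ (phiG e eEF)) => // -[t pt].
  by case/existsP: nD; exists t; rewrite pt.
rewrite DU => g_inj gD gC.
apply/existsP; exists phi; apply/existsP; exists [ffun e => g e].
apply/and3P; split; first exact/injectiveP.
  apply/forall_inP => e1 e1EF; apply/forall_inP => e2 e2EF; rewrite !ffunE.
  by apply/implyP => /eqP/g_inj->.
apply/forall_inP => e eEF; rewrite ffunE.
have [eD|eD] := boolP (e \in D).
  by rewrite gD //; have [t pt ->] := g0P e eD; rewrite hypH -pt pr_hyp.
by have := gC e; rewrite in_setD eD eEF => /(_ isT); rewrite inE.
Qed.

Lemma injection_into (V W : finType) (A : {set W}) :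
  #|V| <= #|A| -> exists2 i : V -> W, injective i & forall v, i v \in A.
Proof.
move=> leVA; exists (fun v => enum_val (widen_ord leVA (enum_rank v))) => [u v|v];
  last exact: enum_valP.
by move=> /enum_val_inj /(congr1 val) /= /val_inj /enum_rank_inj.
Qed.

Lemma clique_copy (V W : finType) (EF : {set {set V}}) (G : {set {set W}}) (Q : {set W}) :
  simple_graph EF -> #|V| <= #|Q| -> {in Q &, forall a b, a != b -> [set a; b] \in G} ->
  contains_copy EF G.
Proof.
move=> /forall_inP sEF /injection_into[i i_inj iQ] QG.
apply/existsP; exists [ffun v => i v]; apply/andP; split.
  by apply/injectiveP => u v; rewrite !ffunE => /i_inj.
apply/forall_inP => e /sEF/cards2P[u [v [nuv ->]]].
rewrite imsetU1 imset_set1 !ffunE QG //.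
by apply: contraNneq nuv => /i_inj->.
Qed.

(** * Triangles in graphs built from hyperedges *)

Definition triangle_set n (E : {set {set 'I_n}}) : {set {set 'I_n}} :=
  [set T : {set 'I_n} | (#|T| == 3) &&
      [forall x in T, forall y in T, (x != y) ==> ([set x; y] \in E)]].

Lemma triangle_mem n (E : {set {set 'I_n}}) (a b c : 'I_n) :
  a != b -> b != c -> a != c ->
  [set a; b] \in E -> [set b; c] \in E -> [set a; c] \in E ->
  [set a; b; c] \in triangle_set E.
Proof.
move=> nab nbc nac Eab Ebc Eac; rewrite inE; apply/andP; split.
  by rewrite -setUA !cardsU1 cards1 !inE negb_or nab nac nbc.
apply/forall_inP => u uT; apply/forall_inP => v vT; apply/implyP.
move: uT vT; rewrite !inE -!orbA.
by case/or3P=> /eqP->; case/or3P=> /eqP->; rewrite ?eqxx //;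
   rewrite ?Eab ?Ebc ?Eac // setUC ?Eab ?Ebc ?Eac.
Qed.

Lemma triangles_le_ex (V : finType) (EF : {set {set V}}) n (E : {set {set 'I_n}}) :
  simple_graph E -> ~~ contains_copy EF E -> #|triangle_set E| <= ex_K3 EF n.
Proof.
by move=> sE nE; apply: (@leq_bigmax_cond _ _ (@triangles n)); rewrite sE.
Qed.

Section TriangleCounts.

Variables (V : finType) (EF : {set {set V}}) (n : nat) (H : {set {set 'I_n}}).
Variables (T : finType) (hyp : T -> {set 'I_n}) (x y z : T -> 'I_n).
Hypothesis noBerge : ~~ contains_berge EF H.
Hypotheses (hyp_inj : injective hyp) (hypH : forall t, hyp t \in H).
Hypothesis xyz_hyp : forall t, [&& x t \in hyp t, y t \in hyp t & z t \in hyp t].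
Hypothesis xyz_neq : forall t, [&& x t != y t, y t != z t & x t != z t].

Lemma blue_pair_bounded (u v : T -> 'I_n) :
  (forall t, (u t \in hyp t) && (v t \in hyp t)) ->
  (forall t, codegree H [set u t; v t] < #|EF|) -> pair_bounded #|EF| u v.
Proof.
move=> uv_hyp blue a b.
have [->|[t0]] := set_0Vmem [set t | (u t == a) && (v t == b)]; first by rewrite cards0.
rewrite inE => /andP[/eqP ua /eqP vb].
rewrite -(card_imset _ hyp_inj); apply: leq_trans (ltnW (blue t0)).
apply: subset_leq_card; apply/subsetP => _ /imsetP[t + ->].
rewrite !inE hypH ua vb subUset !sub1set => /andP[/eqP <- /eqP <-]; exact: uv_hyp.
Qed.

Lemma card_red_red_blue :
  (forall t, #|EF| <= codegree H [set x t; y t]) ->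
  (forall t, #|EF| <= codegree H [set y t; z t]) ->
  (forall t, codegree H [set x t; z t] < #|EF|) ->
  #|T| <= #|EF| * ex_K3 EF n.
Proof.
move=> rxy ryz bxz.
pose pr t := [set x t; z t].
pose G := [set e : {set 'I_n} | (#|e| == 2) && ((#|EF| <= codegree H e) || [exists t, pr t == e])].
have sG : simple_graph G by apply/forall_inP => e; rewrite inE => /andP[].
have nG : ~~ contains_copy EF G.
  apply: contra noBerge; apply: (berge_of_copy hyp_inj hypH (pr := pr)) => [t|e].
    by have /and3P[xh _ zh] := xyz_hyp t; rewrite subUset !sub1set xh.
  rewrite inE => /andP[_ /orP[|/existsP[t /eqP]]]; first by left.
  by right; exists t.
apply: leq_trans (leq_mul (leqnn _) (triangles_le_ex sG nG)).
rewrite -cardsT; apply: (card_le_fibers (f := fun t => [set x t; y t; z t])) => [t _|tau _].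
  have /and3P[nxy nyz nxz] := xyz_neq t.
  apply: triangle_mem => //; rewrite inE cards2 ?nxy ?nyz ?nxz /= ?rxy ?ryz //.
  by apply/orP; right; apply/existsP; exists t.
(* All hyperedges of the fiber contain [tau], hence the blue pair of the fixed [t0], so there are
   fewer than [#|EF|] of them. *)
have [->|[t0]] := set_0Vmem [set t in [set: T] | [set x t; y t; z t] == tau];
  first by rewrite cards0.
rewrite !inE => /eqP tau0.
rewrite -(card_imset _ hyp_inj); apply: leq_trans (ltnW (bxz t0)).
apply: subset_leq_card; apply/subsetP => _ /imsetP[t + ->].
rewrite !inE hypH /= => /eqP tauE.
apply: subset_trans (_ : tau \subset _); first by rewrite -tau0 subUset !sub1set !inE !eqxx !orbT.
by rewrite -tauE -setUA !subUset !sub1set.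
Qed.

Hypothesis bxy : forall t, codegree H [set x t; y t] < #|EF|.
Hypothesis byz : forall t, codegree H [set y t; z t] < #|EF|.
Hypothesis bxz : forall t, codegree H [set x t; z t] < #|EF|.

Let xy_bounded : pair_bounded #|EF| x y.
Proof. by apply: blue_pair_bounded bxy => t; have /and3P[-> ->] := xyz_hyp t. Qed.
Let xz_bounded : pair_bounded #|EF| x z.
Proof. by apply: blue_pair_bounded bxz => t; have /and3P[-> _ ->] := xyz_hyp t. Qed.
Let yz_bounded : pair_bounded #|EF| y z.
Proof. by apply: blue_pair_bounded byz => t; have /and3P[_ -> ->] := xyz_hyp t. Qed.

Lemma card_pair_in (u v : T -> 'I_n) (tau : {set 'I_n}) :
  pair_bounded #|EF| u v -> #|tau| = 3 ->
  #|[set t | (u t \in tau) && (v t \in tau)]| <= 9 * #|EF|.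
Proof.
move=> uv tau3; have -> : 9 * #|EF| = #|EF| * #|setX tau tau| by rewrite cardsX tau3 mulnC.
apply: (card_le_fibers (f := fun t => (u t, v t))) => [t|[a b] _]; first by rewrite !inE.
apply: leq_trans (uv a b); apply: subset_leq_card; apply/subsetP => t.
by rewrite !inE xpair_eqE => /andP[_].
Qed.

Lemma card_rainbow_le : #|rainbow x y z| <= 27 * ((27 * #|EF|) ^ 3 * ex_K3 EF n).
Proof.
have [|f leR] := @select_roles T (rainbow x y z).
  by move=> w; rewrite inE => /and5P[-> -> ->].
apply: leq_trans leR _; rewrite leq_mul2l /=.
(* The role of [t] in a rainbow triangle decides which side it supplies. Each hyperedge thus
   contributes one pair only, as [berge_of_copy] requires. *)
pose pr t := if f t == 0 :> nat then [set x t; z t]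
             else if f t == 1 :> nat then [set y t; z t] else [set x t; y t].
pose G := [set pr t | t : T].
have sG : simple_graph G.
  apply/forall_inP => _ /imsetP[t _ ->]; have /and3P[nxy nyz nxz] := xyz_neq t.
  by rewrite /pr; do 2?case: ifP => _; rewrite cards2 ?nxy ?nyz ?nxz.
have nG : ~~ contains_copy EF G.
  apply: contra noBerge; apply: (berge_of_copy hyp_inj hypH (pr := pr)) => [t|_ /imsetP[t _ ->]].
    have /and3P[xh yh zh] := xyz_hyp t.
    by rewrite /pr; do 2?case: ifP => _; rewrite subUset !sub1set ?xh ?yh ?zh.
  by right; exists t.
apply: leq_trans (leq_mul (leqnn _) (triangles_le_ex sG nG)).
apply: (card_le_fibers (f := fun w => [set x w.2; y w.2; z w.1.1])) => [w|tau tauG].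
  case: w => -[t1 t2] t3; rewrite !inE /=.
  case/andP=> /and5P[_ _ _ /eqP x13 /andP[/eqP y23 /eqP z12]] /and3P[f1 f2 f3].
  have /and3P[nxy _ _] := xyz_neq t3; have /and3P[_ nyz _] := xyz_neq t2.
  have /and3P[_ _ nxz] := xyz_neq t1.
  rewrite -x13 -y23 z12 in nxy *.
  have := triangle_mem (E := G) (a := x t1) (b := y t2) (c := z t2).
  rewrite inE; apply => //.
  - by rewrite -z12.
  - by apply/imsetP; exists t3 => //; rewrite /pr (eqP f3) /= x13 y23.
  - by apply/imsetP; exists t2 => //; rewrite /pr (eqP f2).
  - by apply/imsetP; exists t1 => //; rewrite /pr (eqP f1) z12.
have tau3 : #|tau| = 3 by move: tauG; rewrite inE => /andP[/eqP].
(* Every index of a rainbow triangle on [tau] has two of its three vertices in [tau], which leaves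
   at most [27 * #|EF|] choices for each. *)
pose Q := [set t | (x t \in tau) && (y t \in tau)] :|: ([set t | (x t \in tau) && (z t \in tau)]
   :|: [set t | (y t \in tau) && (z t \in tau)]).
have cardQ : #|Q| <= 27 * #|EF|.
  apply: leq_trans (leq_card_setU _ _) _; rewrite (_ : 27 = 9 + (9 + 9)) // !mulnDl.
  apply: leq_add; first exact: card_pair_in.
  by apply: leq_trans (leq_card_setU _ _) _; apply: leq_add; apply: card_pair_in.
apply: leq_trans (_ : #|setX (setX Q Q) Q| <= _).
  apply: subset_leq_card; apply/subsetP => -[[t1 t2] t3].
  rewrite !inE /= => /andP[/andP[/and5P[_ _ _ /eqP x13 /andP[/eqP y23 /eqP z12]] _] /eqP <-].
  by rewrite x13 y23 -z12 !inE !eqxx !orbT.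
by rewrite !cardsX !expnS expn0 muln1 mulnA !leq_mul.
Qed.

End TriangleCounts.

(** * Hyperedges with a large red class *)

Lemma red_clique_berge (V W : finType) (EF : {set {set V}}) (H : {set {set W}}) (Q : {set W}) :
  simple_graph EF -> #|V| <= #|Q| ->
  {in Q &, forall a b, a != b -> #|EF| <= codegree H [set a; b]} ->
  contains_berge EF H.
Proof.
move=> sEF leVQ red; pose G := [set e | #|EF| <= codegree H e].
(* All edges are red, so the family of blue pairs is empty. *)
apply: (@berge_of_copy _ _ void _ _ G (of_void _) (of_void _)); try by case.
  by move=> e; rewrite inE; left.
by apply: clique_copy sEF leVQ _ => a b aQ bQ nab; rewrite inE red.
Qed.

(* The hypothesis makes red an equivalence relation on [h] with at most two classes. *)
Lemma red_classes_berge (V W : finType) (EF : {set {set V}}) (H : {set {set W}}) (h : {set W}) :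
  simple_graph EF -> (#|V| - 1).*2 < #|h| ->
  let red a b := #|EF| <= codegree H [set a; b] in
  {in h & &, forall a b c, a != b -> b != c -> a != c ->
     ~~ [&& ~~ red a b, ~~ red b c & ~~ red a c] /\ ~~ [&& red a b, red b c & ~~ red a c]} ->
  contains_berge EF H.
Proof.
move=> sEF lth red noT.
have redC a b : red a b = red b a by rewrite /red setUC.
have /card_gt0P[a ah] : 0 < #|h| by apply: leq_ltn_trans lth.
(* [A] is the red class of [a]. Two points of [A] are joined by red since red-red-blue is excluded;
   two points outside [A] are both blue to [a], hence joined by red since blue triangles are
   excluded. *)
pose A := [set b in h | (b == a) || red a b].
have cA : #|A| + #|h :\: A| = #|h|.
  by rewrite -(cardsID A h) (setIidPr _) //; apply/subsetP => b; rewrite inE => /andP[].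
have [leA|ltA] := leqP #|V| #|A|.
  apply: (red_clique_berge sEF leA) => b c.
  rewrite !inE => /andP[bh /orP[/eqP->|ab]] /andP[ch /orP[/eqP->|ac]] nbc //;
    rewrite -/(red _ _) ?eqxx // in nbc *.
    by rewrite redC.
  have [eba|nba] := eqVneq b a; first by rewrite eba.
  have [eca|nca] := eqVneq c a; first by rewrite eca redC.
  have [_] := noT b a c bh ah ch nba (ltac:(by rewrite eq_sym)) nbc.
  by rewrite redC ab ac /= negbK.
have leA : #|V| <= #|h :\: A| by lia.
apply: (red_clique_berge sEF leA) => b c.
rewrite !inE => /andP[+ bh] /andP[+ ch] nbc;
  rewrite bh ch !negb_or /= => /andP[nba ab] /andP[nca ac].
have [+ _] := noT b a c bh ah ch nba (ltac:(by rewrite eq_sym)) nbc.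
by rewrite redC ab ac /= negbK.
Qed.

(** * Dense graphs contain every bipartite graph *)

(** A Kovari-Sos-Turan argument: fix [K] vertices of high degree, and find by pigeonhole [s]
    vertices with the same trace, of size at least [s], on them. *)
Lemma dense_contains_bipartite (V : finType) (EF : {set {set V}}) (k : nat) :
  simple_graph EF -> colorable EF 2 ->
  exists N, forall n (G : {set {set 'I_n}}), N <= n -> simple_graph G -> n ^ 2 <= k * #|G| ->
    contains_copy EF G.
Proof.
move=> /forall_inP sEF /existsP[f /forallP fP].
have fE u v : u != v -> [set u; v] \in EF -> f u != f v.
  by move=> nuv uvE; have /forallP/(_ v)/implyP := fP u; apply; rewrite nuv.
(* With [K = 4 * k * s] a vertex has on average at least [K / (2k) = 2s] neighbours in [A0], twice
   the required trace size. *)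
pose s := #|V|.+1; pose K := 4 * k * s.
exists (2 * k * K + K * 2 ^ K).+1 => n G leNn sG leG.
pose nb a := [set b | [set a; b] \in G].
pose P := [set ab : 'I_n * 'I_n | [set ab.1; ab.2] \in G].
have leGP : #|G| <= #|P|.
  apply: leq_trans (leq_imset_card (fun ab => [set ab.1; ab.2]) (mem P)).
  apply: subset_leq_card; apply/subsetP => e eG.
  have /cards2P[a [b [_ eE]]] := forall_inP sG e eG.
  by apply/imsetP; exists (a, b); rewrite ?inE /= -?eE.
have cardP : #|P| = \sum_(a : 'I_n) #|nb a|.
  rewrite (card_fiber_sum fst P); apply: eq_bigr => a _.
  rewrite -(card_imset (nb a) (f := pair a)); last by move=> b c [].
  apply: eq_card => -[a' b]; rewrite !inE /=; apply/andP/imsetP => [[abG /eqP <-]|[c + [-> ->]]].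
    by exists b; rewrite ?inE.
  by rewrite inE.
pose Hi := [set a | n <= 2 * k * #|nb a|].
(* Vertices outside [Hi] account for at most half of the guaranteed [n ^ 2 / k] ordered pairs, and
   each vertex of [Hi] for at most [n]. *)
have leHi : n <= 2 * k * #|Hi|.
  have le1 : 2 * k * #|P| <= \sum_(a : 'I_n) (n + (a \in Hi) * (2 * k * n)).
    rewrite cardP big_distrr /=; apply: leq_sum => a _; rewrite inE.
    case: (leqP n) => [_|/ltnW]; last by rewrite /= mul0n addn0.
    by rewrite mul1n (leq_trans _ (leq_addl _ _)) // leq_mul2l -[leqRHS]card_ord max_card orbT.
  rewrite big_split /= sum_nat_const card_ord -big_distrl /= in le1.
  have -> : #|Hi| = \sum_(a : 'I_n) (a \in Hi).
    by rewrite -sum1_card big_mkcond; apply: eq_bigr => a _; case: (a \in Hi).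
  set q := \sum_a _ in le1 *.
  have le2 : 2 * (n * n) <= n * n + n * (2 * k * q).
    apply: leq_trans (_ : n * n + q * (2 * k * n) <= _); last by lia.
    apply: leq_trans le1; rewrite -mulnA leq_mul2l /= mulnn.
    by apply: leq_trans leG _; rewrite leq_mul2l leGP orbT.
  have n_gt0 : 0 < n by apply: leq_trans leNn.
  by rewrite -(leq_pmul2l n_gt0); lia.
have k_gt0 : 0 < k.
  by rewrite lt0n; apply: contraTneq leG => ->; rewrite mul0n -ltnNge expn_gt0 (leq_trans _ leNn).
have leKHi : K <= #|Hi|.
  by rewrite -(leq_pmul2l (_ : 0 < 2 * k)) ?muln_gt0 //; lia.
have [A0 A0Hi cA0] : exists2 A0 : {set 'I_n}, A0 \subset Hi & #|A0| = K.
  have /card_geqP[r [ur szr rHi]] := leKHi; exists [set a in r].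
    by apply/subsetP => a; rewrite inE => /rHi.
  by rewrite cardsE (card_uniqP ur).
pose al b := [set a in A0 | [set a; b] \in G].
have [/existsP[A1 /andP[leA1 leB1]]|few] := boolP [exists A1 : {set 'I_n},
   (s <= #|A1|) && (s <= #|[set b | al b == A1]|)]; last first.
  exfalso; rewrite negb_exists in few.
  pose B := [set b | s <= #|al b|].
  have cB : #|B| <= s * 2 ^ K.
    rewrite -cA0 -card_powerset; apply: (card_le_fibers (f := al)) => [b _|A1 _].
      by rewrite inE; apply/subsetP => a; rewrite inE => /andP[].
    have [->|[b0]] := set_0Vmem [set b in B | al b == A1]; first by rewrite cards0.
    rewrite !inE => /andP[le0 /eqP e0].
    have := forallP few A1; rewrite -e0 le0 /= -ltnNge e0 => /ltnW; apply: leq_trans.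
    by apply: subset_leq_card; apply/subsetP => b; rewrite !inE => /andP[].
  have dbl : \sum_(b : 'I_n) #|al b| = \sum_(a in A0) #|nb a|.
    transitivity (\sum_(b : 'I_n) \sum_(a in A0) ([set a; b] \in G)).
      apply: eq_bigr => b _; rewrite -sum1dep_card (big_mkcondr _ (index_enum _) (mem A0) (fun a
        => [set a; b] \in G)).
      by apply: eq_bigr => a _; case: ([set a; b] \in G).
    rewrite exchange_big /=; apply: eq_bigr => a _; rewrite -sum1dep_card [RHS]big_mkcond.
    by apply: eq_bigr => b _; case: ([set a; b] \in G).
  have lo : K * n <= 2 * k * \sum_(b : 'I_n) #|al b|.
    rewrite dbl -cA0 -sum_nat_const big_distrr /=; apply: leq_sum => a /(subsetP A0Hi).
    by rewrite inE.
  have hi : \sum_(b : 'I_n) #|al b| <= n * s + K * #|B|.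
    apply: leq_trans (_ : \sum_(b : 'I_n) (s + K * (b \in B)) <= _).
      apply: leq_sum => b _; rewrite inE; case: (leqP s) => [_|/ltnW];
        last by rewrite /= muln0 addn0.
      rewrite muln1 -cA0; apply: leq_trans (leq_addl _ _); apply: subset_leq_card.
      by apply/subsetP => a; rewrite inE => /andP[].
    rewrite big_split /= sum_nat_const card_ord -big_distrr /= leq_add2l leq_mul2l -sum1_card
      [leqRHS]big_mkcond.
    by apply/orP; right; apply: leq_sum => b _; case: (b \in B).
  have {}hi : 2 * k * s * n <= 2 * k * s * (K * 2 ^ K).
    rewrite -(leq_add2l (2 * k * s * n)); apply: leq_trans (_ : K * n <= _); first by rewrite /K;
      lia.
    apply: leq_trans lo _; apply: leq_trans (leq_mul (leqnn _) hi) _.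
    have := leq_mul (leqnn (2 * k * K)) cB; lia.
  by rewrite leq_pmul2l ?muln_gt0 ?k_gt0 // in hi; lia.
have [i1 i1_inj i1A] := injection_into (ltnW leA1).
have [i2 i2_inj i2B] := injection_into (ltnW leB1).
have cross u v : [set i1 u; i2 v] \in G.
  have := i2B v; rewrite inE => /eqP alv; have := i1A u; rewrite -alv.
  by rewrite inE => /andP[].
have neq u v : i1 u != i2 v.
  apply: contraTneq (cross u v) => ->; apply/negP => /(forall_inP sG).
  by rewrite setUid cards1.
pose c v := f v == ord0.
have cE u v : u != v -> [set u; v] \in EF -> c u != c v.
  move=> nuv /(fE u v nuv); rewrite /c -!val_eqE /=.
  by case: (f u) => -[|[|//]] /= _; case: (f v) => -[|[|//]].
apply/existsP; exists [ffun v => if c v then i1 v else i2 v]; apply/andP; split.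
  apply/injectiveP => u v; rewrite !ffunE; case: (c u); case: (c v).
  - exact: i1_inj.
  - by move/eqP; rewrite (negbTE (neq _ _)).
  - by move/esym/eqP; rewrite (negbTE (neq _ _)).
  - exact: i2_inj.
apply/forall_inP => e eEF; have /cards2P[u [v [nuv eE]]] := sEF e eEF.
have := cE u v nuv; rewrite -eE => /(_ eEF); rewrite eE imsetU1 imset_set1 !ffunE.
by case: (c u); case: (c v) => // _; rewrite // setUC.
Qed.

(** * Asymptotics in integer form *)

Lemma is_o_n2P (f : nat -> nat) :
  is_o_n2 f <-> forall k, exists N, forall n, N <= n -> k * f n <= n ^ 2.
Proof.
split=> [fo k | fo eps eps_gt0].
  have k_gt0 : (0 < k.+1%:R :> rat)%R by rewrite ltr0n.
  have [|N fN] := fo k.+1%:R^-1%R; first by rewrite invr_gt0.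
  exists N => n /fN; rewrite ler_pdivlMl // -natrX -natrM ler_nat => /(leq_trans _); apply.
  by rewrite leq_mul2r leqnSn orbT.
have [N fN] := fo (Num.bound eps^-1%R).
exists N => n /fN; set k := Num.bound _ => le.
have k_gt : (eps^-1 < k%:R :> rat)%R by apply: archi_boundP; rewrite invr_ge0 ltW.
rewrite mulrC -ler_pdivrMr // mulrC; apply: le_trans (_ : k%:R * (f n)%:R <= _)%R.
  by rewrite ler_wpM2r ?ler0n // ltW.
by rewrite -natrM -natrX ler_nat.
Qed.

Lemma ex_berge_bound (V : finType) (EF : {set {set V}}) r n k m :
  (forall H : {set {set 'I_n}}, uniform r H -> ~~ contains_berge EF H -> k * #|H| <= m) ->
  k * ex_berge r EF n <= m.
Proof.
move=> bound; rewrite /ex_berge; apply: (big_ind (fun t => k * t <= m)); first by rewrite muln0.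
  by move=> s t ks kt; rewrite /maxn; case: ifP.
by move=> H /andP[]; apply: bound.
Qed.

Lemma contains_berge_edgeless (V W : finType) (H : {set {set W}}) :
  #|V| <= #|W| -> contains_berge (set0 : {set {set V}}) H.
Proof.
rewrite -[#|W|]cardsT => /injection_into[i i_inj _].
apply/existsP; exists [ffun v => i v]; apply/existsP; exists [ffun=> set0].
apply/and3P; split; try by apply/forall_inP => e; rewrite inE.
by apply/injectiveP => u v; rewrite !ffunE => /i_inj.
Qed.

(** Turns a subfamily of hyperedges with chosen witnesses into the indexed form used by the counting
    lemmas. *)
Lemma pick_in_edges (n : nat) (U : finType) (H H' : {set {set 'I_n}}) (P : {set 'I_n} -> U ->
  bool) :
  H' \subset H -> (forall h, h \in H' -> exists w, P h w) ->
  exists (T : finType) (hyp : T -> {set 'I_n}) (w : T -> U),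
    [/\ #|T| = #|H'|, injective hyp, forall t, hyp t \in H & forall t, P (hyp t) (w t)].
Proof.
move=> sub PH'.
have [w Pw] := fin_all_exists (fun t : {h | h \in H'} => PH' (val t) (valP t)).
exists {h | h \in H'}, val, w; split=> //; first by rewrite card_sig.
  exact: val_inj.
by move=> t; apply: (subsetP sub); apply: valP.
Qed.

(** * Bounds for Berge-free hypergraphs and the theorem *)

Section UniformityThreshold.

Variables (V : finType) (EF : {set {set V}}).
Hypothesis sEF : simple_graph EF.

Lemma ex_berge_bipartite r : #|V| <= r -> colorable EF 2 -> is_o_n2 (ex_berge r EF).
Proof.
move=> leVr col; apply/is_o_n2P => k.
(* The factor [#|EF|] pays for the hyperedges that share the same chosen blue pair. *)
have [N HN] := dense_contains_bipartite (k * #|EF|) sEF col.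
exists N => n leNn; apply: ex_berge_bound => H /forall_inP uH noB.
pose P (h : {set 'I_n}) (w : 'I_n * 'I_n) :=
  [&& w.1 \in h, w.2 \in h, w.1 != w.2 & codegree H [set w.1; w.2] < #|EF|].
have [|h hH|T [hyp [w [cT hyp_inj hypH Pw]]]] := @pick_in_edges n _ H H P => //.
  apply/existsP; apply: contraNT noB; rewrite negb_exists => /forallP nP.
  apply: (red_clique_berge (Q := h)) => //; first by rewrite (eqP (uH h hH)).
  move=> a b ah bh nab; have := nP (a, b).
  by rewrite /P ah bh nab /= -leqNgt.
pose pr t := [set (w t).1; (w t).2].
have pr_hyp t : pr t \subset hyp t by have /and4P[ah bh _ _] := Pw t; rewrite subUset !sub1set ah.
pose G := [set pr t | t : T].
have leTG : #|T| <= #|EF| * #|G|.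
  rewrite -cardsT; apply: (card_le_fibers (f := pr)) => [t _|e _]; first exact: imset_f.
  have [->|[t0]] := set_0Vmem [set t in [set: T] | pr t == e]; first by rewrite cards0.
  rewrite !inE => /eqP <-; have /and4P[_ _ _ /ltnW] := Pw t0; apply: leq_trans.
  rewrite -(card_imset _ hyp_inj); apply: subset_leq_card; apply/subsetP => _ /imsetP[t + ->].
  by rewrite !inE hypH /= => /eqP; rewrite {2}/pr => <-.
have sG : simple_graph G.
  by apply/forall_inP => _ /imsetP[t _ ->]; have /and4P[_ _ nab _] := Pw t; rewrite cards2 nab.
rewrite -cT; apply: leq_trans (leq_mul (leqnn k) leTG) _; rewrite leqNgt.
apply: contra noB => ltG.
apply: (berge_of_copy hyp_inj hypH pr_hyp (G := G)) => [_ /imsetP[t _ ->]|]; first by right;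
  exists t.
by apply: HN leNn sG _; rewrite -mulnA ltnW.
Qed.

Lemma ex_berge_small_classes r : (#|V| - 1).*2 < r -> is_o_n2 (ex_K3 EF) -> is_o_n2 (ex_berge r EF).
Proof.
move=> ltVr /is_o_n2P oK3; apply/is_o_n2P => k.
have [c [N1 rainN1]] := many_rainbow #|EF| (2 * k).
(* The successor turns the two opposite bounds on [n ^ 2] into [ex_K3 EF n = 0], hence [n ^ 2 = 0],
   a contradiction. *)
have [N2 exN2] := oK3 (c * (27 * (27 * #|EF|) ^ 3)).+1.
have [N3 exN3] := oK3 (2 * k * #|EF|).
exists (N1 + N2 + N3).+1 => n leNn; apply: ex_berge_bound => H /forall_inP uH noB.
pose red (a b : 'I_n) := #|EF| <= codegree H [set a; b].
pose inh (h : {set 'I_n}) (w : 'I_n * 'I_n * 'I_n) :=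
  [&& [&& w.1.1 \in h, w.1.2 \in h & w.2 \in h] &
      [&& w.1.1 != w.1.2, w.1.2 != w.2 & w.1.1 != w.2]].
pose P1 h w := inh h w && [&& ~~ red w.1.1 w.1.2, ~~ red w.1.2 w.2 & ~~ red w.1.1 w.2].
pose P2 h w := inh h w && [&& red w.1.1 w.1.2, red w.1.2 w.2 & ~~ red w.1.1 w.2].
pose H1 := [set h in H | [exists w, P1 h w]].
pose H2 := [set h in H | [exists w, P2 h w]].
have cH : #|H| <= #|H1| + #|H2|.
  apply: leq_trans (leq_card_setU _ _); apply: subset_leq_card; apply/subsetP => h hH.
  rewrite !inE hH /=; apply: contraR noB; rewrite negb_or => /andP[/existsPn n1 /existsPn n2].
  apply: (red_classes_berge (h := h)) => //; first by rewrite (eqP (uH h hH)).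
  move=> a b c' ah bh ch nab nbc nac; have := n1 (a, b, c'); have := n2 (a, b, c').
  by rewrite /P1 /P2 /inh /= ah bh ch nab nbc nac.
have cH1 : 2 * k * #|H1| <= n ^ 2.
  have [||T [hyp [w [<- hyp_inj hypH Pw]]]] := @pick_in_edges n _ H H1 P1.
  - by apply/subsetP => h; rewrite inE => /andP[].
  - by move=> h; rewrite inE => /andP[_ /existsP].
  pose x t := (w t).1.1; pose y t := (w t).1.2; pose z t := (w t).2.
  have xyz_hyp t : [&& x t \in hyp t, y t \in hyp t & z t \in hyp t].
    by have /andP[/andP[]] := Pw t.
  have xyz_neq t : [&& x t != y t, y t != z t & x t != z t] by have /andP[/andP[]] := Pw t.
  have bxy t : codegree H [set x t; y t] < #|EF| by have /andP[_ /and3P[]] := Pw t; rewrite -ltnNge.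
  have byz t : codegree H [set y t; z t] < #|EF|.
    by have /andP[_ /and3P[_]] := Pw t; rewrite -ltnNge.
  have bxz t : codegree H [set x t; z t] < #|EF|.
    by have /andP[_ /and3P[_ _]] := Pw t; rewrite -ltnNge.
  have leR := card_rainbow_le noB hyp_inj hypH xyz_hyp xyz_neq bxy byz bxz.
  have bxy' : pair_bounded #|EF| x y.
    by apply: (blue_pair_bounded hyp_inj hypH) bxy => t; have /and3P[-> ->] := xyz_hyp t.
  have bxz' : pair_bounded #|EF| x z.
    by apply: (blue_pair_bounded hyp_inj hypH) bxz => t; have /and3P[-> _ ->] := xyz_hyp t.
  have byz' : pair_bounded #|EF| y z.
    by apply: (blue_pair_bounded hyp_inj hypH) byz => t; have /and3P[_ -> ->] := xyz_hyp t.
  rewrite leqNgt; apply/negP => ltT.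
  have := rainN1 _ _ x y z bxy' bxz' byz'; rewrite card_ord => /(_ _ (ltnW ltT)) => lec.
  have {}lec : n ^ 2 <= c * #|rainbow x y z| by apply: lec; lia.
  have := exN2 n; have := leq_trans lec (leq_mul (leqnn c) leR).
  set X := ex_K3 EF n; set D := (27 * #|EF|) ^ 3 => le1 /(_ ltac:(lia)) le2.
  have : 0 < n ^ 2 by rewrite expn_gt0 (leq_trans _ leNn).
  move: le1 le2; rewrite mulSn !mulnA; set u := c * 27 * D * X.
  case: X @u => [|X] u; rewrite ?muln0; lia.
have cH2 : 2 * k * #|H2| <= n ^ 2.
  have [||T [hyp [w [<- hyp_inj hypH Pw]]]] := @pick_in_edges n _ H H2 P2.
  - by apply/subsetP => h; rewrite inE => /andP[].
  - by move=> h; rewrite inE => /andP[_ /existsP].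
  apply: leq_trans (exN3 n _); last by lia.
  rewrite -[leqRHS]mulnA leq_mul2l; apply/orP; right.
  apply: (card_red_red_blue (x := fun t => (w t).1.1) (y := fun t => (w t).1.2) (z := fun t =>
    (w t).2) noB hyp_inj hypH) => t.
  - by have /andP[/andP[]] := Pw t.
  - by have /andP[/andP[]] := Pw t.
  - by have /andP[_ /and3P[]] := Pw t.
  - by have /andP[_ /and3P[]] := Pw t.
  - by have /andP[_ /and3P[_ _]] := Pw t; rewrite -ltnNge.
have := leq_mul (leqnn k) cH; lia.
Qed.

End UniformityThreshold.

Theorem theorem5 (V : finType) (EF : {set {set V}}) :
  simple_graph EF ->
  is_o_n2 (ex_K3 EF) ->
  forall r : nat, ((chi EF - 1) * (#|V| - 1) + 1 <= r)%N ->
    is_o_n2 (ex_berge r EF).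
Proof.
(* For edgeless [EF] a Berge copy exists once [n >= #|V|], so the maximum is over no hypergraph and
   equals 0. *)
move=> sEF oK3 r; have [->|[e eEF]] := set_0Vmem EF.
  move=> _; apply/is_o_n2P => k; exists #|V| => n leVn; apply: ex_berge_bound => H _.
  by rewrite contains_berge_edgeless ?card_ord.
have /cards2P[u [v [nuv eE]]] := forall_inP sEF e eEF.
rewrite /chi; case: ex_minnP => c colc _.
have c_gt1 : 1 < c.
  have /existsP[f /forallP/(_ u)/forallP/(_ v)] := colc; rewrite nuv -eE eEF /= -val_eqE /=.
  by case: c f {colc} => [|[|//]] f; [case: (f u) | rewrite !ord1].
have V_gt0 : 0 < #|V| by apply/card_gt0P; exists u.
(* For [c = 2] the threshold is [#|V|]; for [c >= 3] it exceeds [2 * (#|V| - 1)]. These are exactly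
   the uniformities that the two bounds ask for. *)
have [c2|c_gt2] := leqP c 2.
  have {c2 c_gt1} c2 : c = 2 by lia.
  by subst c => leVr; apply: ex_berge_bipartite => //; lia.
by move=> leVr; apply: ex_berge_small_classes => //; nia.
Qed.
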